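(* Let $\mathcal{U}$ be a quasi-definite vector of linear functionals with generalized Markov function $\mathcal{F}$, and let $\{V_m\}_{m\in\mathbb{N}}$ and $\{G_m\}_{m\in\mathbb{N}}$ be sequences of $N\times N$ matrix polynomials that are bi-orthogonal with respect to $\mathcal{F}$, where $\mathcal{B}_m(x)=V_m(h(x))\mathcal{P}_0(x)$. Let $\{\mathcal{B}^{(1)}_m\}_{m\in\mathbb{N}}$ and $\{G^{(1)}_m\}_{m\in\mathbb{N}}$ be the sequences of associated matrix polynomials of the first kind for $\{\mathcal{B}_m\}_{m\in\mathbb{N}}$ and $\{G_m\}_{m\in\mathbb{N}}$, respectively. Then for every $m\ge 0$ $$\mathcal{B}^{(1)}_{m}(z)G_{m}(z)-V_{m+1}(z)G^{(1)}_{m-1}(z)=A_m^{-1},$$ where $A_m$ is the non-singular matrix coefficient in the recurrence relation $h(x)\mathcal{B}_m(x)=A_m\mathcal{B}_{m+1}(x)+B_m\mathcal{B}_m(x)+C_m\mathcal{B}_{m-1}(x)$.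
   Context: Fix $N\ge 1$ and a complex polynomial $h$ of degree $N$. Put $\mathcal{P}_0(x)=[1,x,\dots,x^{N-1}]^T$ and $\mathcal{P}_j(x)=h(x)^j\mathcal{P}_0(x)$. A vector of linear functionals $\mathcal{U}=[u^1,\dots,u^N]^T$ consists of linear functionals $u^j$ on $\mathbb{C}[x]$; it acts on a vector polynomial $\mathcal{P}=[p_1,\dots,p_N]^T$ by letting $\mathcal{U}(\mathcal{P})$ be the $N\times N$ matrix with $(i,j)$ entry $\langle u^j,p_i\rangle$. One sets $(h^k\mathcal{U})(\mathcal{P})=\mathcal{U}(h^k\mathcal{P})$ and, for a matrix polynomial $G(z)=\sum_k\beta_kz^k$, $(G^T(h(x))\mathcal{U})(\mathcal{P})=\sum_k\mathcal{U}(h^k\mathcal{P})\beta_k$. The notation $\mathcal{U}_x$ means that $\mathcal{U}$ acts on the variable $x$ (an $N\times N$ matrix-valued quantity $Q(x)$ multiplying $\mathcal{P}_0(x)$ gives a vector polynomial $Q\mathcal{P}_0$; if $Q(x)=\sum_k q_k h(x)^k$ with $N\times N$ matrix coefficients $q_k$ not depending on $x$ (they may depend on a parameter $z$), then $[Q^T\mathcal{U}_x](\mathcal{P}_0)=\sum_k\mathcal{U}(h^k\mathcal{P}_0)q_k$). With $\mathcal{U}_j=\mathcal{U}(\mathcal{P}_j)$, $\mathcal{U}$ is quasi-definite if all leading principal submatrices of the block Hankel matrices $[\mathcal{U}_{i+j}]_{i,j=0}^m$, $m\in\mathbb{N}$, are non-singular. The generalized Markov function of $\mathcal{U}$ is $\mathcal{F}(z)=\mathcal{U}_x\left(\frac{\mathcal{P}_0(x)}{z-h(x)}\right)=\sum_{k\ge0}\mathcal{U}(h^k\mathcal{P}_0)z^{-k-1}$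 ($|z|>|h(x)|$ for $x\in L=\bigcup_j\operatorname{supp}u^j$). Sequences $\{V_m\}$, $\{G_m\}$ of matrix polynomials with $\deg V_m=\deg G_m=m$ are bi-orthogonal with respect to $\mathcal{F}$ if $\frac{1}{2\pi i}\int_C V_m(z)\mathcal{F}(z)G_n(z)\,dz=I_{N\times N}\delta_{n,m}$ for all $n,m$, with $C$ a closed path in the region $|z|>|h(x)|$, $x\in L$; equivalently $((G_n(h(x)))^T\mathcal{U}_x)(\mathcal{B}_m)=I_{N\times N}\delta_{n,m}$ where $\mathcal{B}_m(x)=V_m(h(x))\mathcal{P}_0(x)$. These sequences satisfy $zV_m=A_mV_{m+1}+B_mV_m+C_mV_{m-1}$ and $zG_m=G_{m-1}A_{m-1}+G_mB_m+G_{m+1}C_{m+1}$, with $A_m$ non-singular lower triangular, $C_m$ non-singular upper triangular, $V_{-1}=G_{-1}=0$, $V_0=I_{N\times N}$, $G_0=\mathcal{U}(\mathcal{P}_0)^{-1}$. The associated polynomials of the first kind are $$\mathcal{B}^{(1)}_m(z)=\mathcal{U}_x\left(\frac{V_{m+1}(z)-V_{m+1}(h(x))}{z-h(x)}\mathcal{P}_0(x)\right),\qquad G^{(1)}_m(z)=\left[\left(\frac{G^T_{m+1}(z)-G^T_{m+1}(h(x))}{z-h(x)}\right)\mathcal{U}_x\right](\mathcal{P}_0(x)),$$ with $\mathcal{B}^{(1)}_{-1}=G^{(1)}_{-1}=0_{N\times N}$. *)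

(* Defs.v *)
From HB Require Import structures.
From mathcomp Require Import all_boot all_order all_algebra.
From mathcomp Require Import reals.
From mathcomp.real_closed Require Export complex.
Set Implicit Arguments.
Unset Strict Implicit.
Unset Printing Implicit Defensive.
Import GRing.Theory.
Local Open Scope ring_scope.

(* N = n.+1 throughout, which encodes N >= 1 and makes N x N
   matrices a nontrivial ring; matrix polynomials are {poly 'M[K]_n.+1}, with
   deg V = m written size V = m.+1 and V(z) written V.[z%:M].  *)

Section Defs.
Variables (K : fieldType) (n : nat).
Implicit Types (h : {poly K}) (U : 'I_n.+1 -> {scalar {poly K}}).
Implicit Types (V G Q : {poly 'M[K]_n.+1}) (z : K) (m k : nat).

(* Sequences indexed from -1, with value 0 at -1: [pred_seq S m] is S_(m-1). *)
Definition pred_seq (T : zmodType) (S : nat -> T) m : T :=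
  if m is k.+1 then S k else 0.

Definition P0 : 'cV[{poly K}]_n.+1 := \col_i 'X^i.

Definition Pj h j : 'cV[{poly K}]_n.+1 := h ^+ j *: P0.

Definition vact U (P : 'cV[{poly K}]_n.+1) : 'M[K]_n.+1 :=
  \matrix_(i, j) U j (P i 0).

(* (G^T(h(x)) U)(P) = sum_k U(h^k P) g_k; G is the untransposed polynomial. *)
Definition vactT h U G (P : 'cV[{poly K}]_n.+1) : 'M[K]_n.+1 :=
  \sum_(k < size G) vact U (h ^+ k *: P) *m G`_k.

(* V(h(x)), an N x N matrix with entries in K[x]. *)
Definition comp_mx V h : 'M[{poly K}]_n.+1 :=
  (map_poly (map_mx polyC) V).[h%:M].

Definition vecpoly h V : 'cV[{poly K}]_n.+1 := comp_mx V h *m P0.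

Definition hankel h U m :=
  \mxblock_(i < m.+1, j < m.+1) (vact U (Pj h (i + j)) : 'M_(n.+1, n.+1)).

(* Every leading principal submatrix, of any scalar order k (not only the
   multiples of N), is non-singular. *)
Definition quasi_definite h U : Prop :=
  forall m k (hk : (k <= \sum_(i < m.+1) n.+1)%N),
    mxsub (widen_ord hk) (widen_ord hk) (hankel h U m) \in unitmx.

(* Functionals on K[x] are purely algebraic, so bi-orthogonality is expressed
   by ((G_l(h(x)))^T U_x)(B_m) = delta_(l,m) I; biorthogonalP gives the form
   involving the Markov function. *)
Definition biorthogonal h U (V G : nat -> {poly 'M[K]_n.+1}) : Prop :=
  [/\ forall m, size (V m) = m.+1,
      forall m, size (G m) = m.+1 &
      forall l m, vactT h U (G l) (vecpoly h (V m)) = (l == m)%:R%:M].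

(* The Markov function F(z) = sum_k F_k z^(-k-1) as a formal series at
   infinity, given by its coefficients F_k. *)
Definition markov h U k : 'M[K]_n.+1 := vact U (Pj h k).

(* The coefficient of 1/z in V(z) F(z) G(z), that is, the value of
   (1 / (2 pi i)) \oint V(z) F(z) G(z) dz. *)
Definition residue V (F : nat -> 'M[K]_n.+1) G : 'M[K]_n.+1 :=
  \sum_(i < size V) \sum_(j < size G) V`_i *m F (i + j)%N *m G`_j.

(* The coefficient B_m of the recurrence relation is named Bc m, to keep it
   apart from the vector polynomial B m. *)
Definition recurrence h (V : nat -> {poly 'M[K]_n.+1})
    (A Bc Cc : nat -> 'M[K]_n.+1) : Prop :=
  let B m := vecpoly h (V m) in
  forall m, h *: B m =
    map_mx polyC (A m) *m B m.+1 + map_mx polyC (Bc m) *m B m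
    + map_mx polyC (Cc m) *m pred_seq B m.

(* (V(z) - V(w)) / (z - w) as a matrix polynomial in w, both terms of the
   quotient being negated to divide by a monic polynomial: see divdiffP. *)
Definition divdiff V z : {poly 'M[K]_n.+1} :=
  Pdiv.Ring.rdivp (V - (V.[z%:M])%:P) ('X - (z%:M)%:P).

Definition assocB h U (V : nat -> {poly 'M[K]_n.+1}) m z : 'M[K]_n.+1 :=
  vact U (comp_mx (divdiff (V m.+1) z) h *m P0).

Definition assocG h U (G : nat -> {poly 'M[K]_n.+1}) m z : 'M[K]_n.+1 :=
  vactT h U (divdiff (G m.+1) z) P0.

Lemma divdiffP V z : divdiff V z * ((z%:M)%:P - 'X) = (V.[z%:M])%:P - V.
Proof.
have [q Eq] : exists q, V - (V.[z%:M])%:P = q * ('X - (z%:M)%:P).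
  by apply/factor_theorem; rewrite /root !hornerE subrr.
rewrite /divdiff Eq Pdiv.RingMonic.rdivp_mull ?monicXsubC //.
by rewrite -(opprB 'X) mulrN -Eq opprB.
Qed.

Lemma comp_mxE V h :
  comp_mx V h = \sum_(k < size V) h ^+ k *: map_mx polyC V`_k.
Proof.
rewrite /comp_mx (@horner_coef_wide _ (size V)) ?size_poly //.
apply: eq_bigr => k _; rewrite coef_map_id0 ?map_mx0 //.
by rewrite -rmorphXn /= -mulmxE mul_mx_scalar.
Qed.

(* The defining property, in the variable x, of the quotient in assocB. *)
Lemma comp_divdiffP V z h :
  (z%:P - h) *: comp_mx (divdiff V z) h
  = map_mx polyC (V.[z%:M]) - comp_mx V h.
Proof.
have := congr1 (fun Q => comp_mx Q h) (divdiffP V z).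
rewrite /comp_mx /= rmorphM !rmorphB /= !map_polyC map_polyX /= hornerM_comm.
  rewrite !hornerE map_scalar_mx /= => <-.
  by rewrite -raddfB -mulmxE mul_mx_scalar.
by rewrite /comm_poly !hornerE map_scalar_mx /= -raddfB -!mulmxE scalar_mxC.
Qed.

Lemma vact_mull U (M : 'M[K]_n.+1) P : vact U (map_mx polyC M *m P) = M *m vact U P.
Proof.
apply/matrixP => i j; rewrite !mxE linear_sum; apply: eq_bigr => k _.
by rewrite !mxE mul_polyC linearZ.
Qed.

Lemma vact_sum U I (r : seq I) (P : I -> 'cV[{poly K}]_n.+1) :
  vact U (\sum_(i <- r) P i) = \sum_(i <- r) vact U (P i).
Proof.
apply/matrixP => i j; rewrite mxE !summxE linear_sum.
by apply: eq_bigr => k _; rewrite mxE.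
Qed.

Lemma vactT_residue h U V G :
  vactT h U G (vecpoly h V) = residue V (markov h U) G.
Proof.
rewrite /vactT /residue exchange_big; apply: eq_bigr => j _ /=.
rewrite /vecpoly comp_mxE mulmx_suml scaler_sumr vact_sum mulmx_suml.
apply: eq_bigr => i _; rewrite -vact_mull /markov /Pj; congr (vact U _ *m _).
by rewrite -scalemxAl -!scalemxAr scalerA -exprD addnC.
Qed.

Lemma biorthogonalP h U (V G : nat -> {poly 'M[K]_n.+1}) :
  biorthogonal h U V G <->
  [/\ forall m, size (V m) = m.+1,
      forall m, size (G m) = m.+1 &
      forall l m, residue (V m) (markov h U) (G l) = (l == m)%:R%:M].
Proof.
by split=> -[sV sG bi]; split=> // l m; move: (bi l m); rewrite vactT_residue.
Qed.

End Defs.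

(* Main.v *)
Require Import Defs.
From mathcomp Require Import all_boot all_order all_algebra.
From mathcomp Require Import reals.
From mathcomp.real_closed Require Import complex.
Import GRing.Theory.
Local Open Scope ring_scope.

(** Write <P, Q> for the residue of P(z) F(z) Q(z), where F is the Markov
function.  It is left linear in P and right linear in Q over the matrices,
and multiplication by z may be moved from one argument to the other
([residueX]).  Bi-orthogonality says that <V_m, G_l> is the identity when
l = m and zero otherwise.

Let lc_m be the leading coefficient of V_m.  By induction on m, lc_m is
invertible: V_0, ..., V_(m-1) then generate the polynomials of degree less
than m as a left module, so G_m is orthogonal to these, and <V_m, G_m> = 1
reduces to lc_m <z^m, G_m> = 1, which makes lc_m a unit since one-sided
inverses of square matrices are two-sided ([lead_unit]).  Hence, for P of
degree at most m, <P, G_m> = p_m lc_m^-1 with p_m the coefficient of z^m in P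
([residue_lead]).  This formula is used twice.

First, pairing the recurrence relation with G_(m+1) gives
A_m = <z V_m, G_(m+1)> = lc_m lc_(m+1)^-1 ([recurrence_coefA]).

Second, let D P(w) = (P(z) - P(w)) / (z - w).  The associated polynomials are
<D V_(m+1), 1> and <1, D G_m>.  Moving the factor z - w across the pairing,
  <D V_(m+1), G_m(z) - G_m> = <D V_(m+1), (D G_m) (z - w)>
    = <V_(m+1)(z) - V_(m+1), D G_m> = V_(m+1)(z) <1, D G_m>,
because D G_m has degree less than m + 1 and so is orthogonal to V_(m+1).
The left-hand side of the theorem is therefore <D V_(m+1), G_m>, where
D V_(m+1) has degree m and leading coefficient lc_(m+1): its value is
lc_(m+1) lc_m^-1 = A_m^-1 ([residue_divdiff_biorthogonal]). *)

Set Implicit Arguments.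
Unset Strict Implicit.

(** * The residue pairing *)

Section Residue.
Variables (K : fieldType) (n : nat).
Local Notation M := 'M[K]_n.+1.
Implicit Types (F : nat -> M) (P Q : {poly M}) (C : M) (z : K).

Lemma sum_ord_wide (T : nmodType) (f : nat -> T) a b :
  (a <= b)%N -> (forall i, (a <= i)%N -> f i = 0) ->
  \sum_(i < b) f i = \sum_(i < a) f i.
Proof.
move=> leab f0; rewrite (big_ord_widen b f leab) [RHS]big_mkcond /=.
by apply: eq_bigr => i _; case: ltnP => // /f0.
Qed.

(** [residue] sums over the actual sizes; summing over larger ranges instead
lets polynomials of different sizes be compared term by term. *)
Lemma residue_wide p q P F Q : (size P <= p)%N -> (size Q <= q)%N ->
  residue P F Q = \sum_(i < p) \sum_(j < q) P`_i * F (i + j)%N * Q`_j.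
Proof.
move=> leP leQ; rewrite /residue.
rewrite -(@sum_ord_wide _ (fun i => \sum_(j < size Q) P`_i *m F (i + j)%N *m Q`_j) _ p leP).
  apply: eq_bigr => i _.
  rewrite -(@sum_ord_wide _ (fun j => P`_i *m F (i + j)%N *m Q`_j) _ q leQ) //.
  by move=> j lej; rewrite (nth_default _ lej) mulmx0.
by move=> i lei; apply: big1 => j _; rewrite (nth_default _ lei) !mul0mx.
Qed.

Lemma residueDl P1 P2 F Q :
  residue (P1 + P2) F Q = residue P1 F Q + residue P2 F Q.
Proof.
have le1 := leq_maxl (size P1) (size P2); have le2 := leq_maxr (size P1) (size P2).
rewrite (residue_wide F (size_polyD P1 P2) (leqnn (size Q))).
rewrite (residue_wide F le1 (leqnn _)) (residue_wide F le2 (leqnn (size Q))).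
rewrite -big_split; apply: eq_bigr => i _; rewrite -big_split; apply: eq_bigr => j _.
by rewrite coefD !mulrDl.
Qed.

Lemma residueCl C P F Q : residue (C%:P * P) F Q = C * residue P F Q.
Proof.
have le1 : (size (C%:P * P)%R <= size P)%N.
  by apply/leq_sizeP => j lej; rewrite coefCM nth_default ?mulr0.
rewrite (residue_wide F le1 (leqnn _)) mulr_sumr; apply: eq_bigr => i _.
by rewrite mulr_sumr; apply: eq_bigr => j _; rewrite coefCM -!mulmxE !mulmxA.
Qed.

Lemma residue0l F Q : residue 0 F Q = 0.
Proof. by rewrite /residue size_poly0 big_ord0. Qed.

Lemma residueNl P F Q : residue (- P) F Q = - residue P F Q.
Proof. by apply/eqP; rewrite -addr_eq0 -residueDl addNr residue0l. Qed.

Lemma residueBl P1 P2 F Q :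
  residue (P1 - P2) F Q = residue P1 F Q - residue P2 F Q.
Proof. by rewrite residueDl residueNl. Qed.

(** Transposition reverses products, hence exchanges the two arguments of the
residue pairing: every property of the left argument passes to the right. *)
Definition trmx_poly P : {poly M} := map_poly trmx P.

Lemma coef_trmx_poly P i : (trmx_poly P)`_i = (P`_i)^T.
Proof. by rewrite /trmx_poly coef_map_id0 ?trmx0. Qed.

Lemma size_trmx_poly P : size (trmx_poly P) = size P.
Proof. by rewrite /trmx_poly size_map_inj_poly ?trmx0 //; apply: trmx_inj. Qed.

Lemma residue_tr P F Q :
  residue (trmx_poly Q) (fun k => (F k)^T) (trmx_poly P) = (residue P F Q)^T.
Proof.
rewrite /residue !size_trmx_poly exchange_big raddf_sum; apply: eq_bigr => i _ /=.
rewrite raddf_sum; apply: eq_bigr => j _ /=.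
by rewrite !coef_trmx_poly !trmx_mul mulmxA addnC.
Qed.

Lemma residue_trE P F Q :
  residue P F Q = (residue (trmx_poly Q) (fun k => (F k)^T) (trmx_poly P))^T.
Proof. by rewrite residue_tr trmxK. Qed.

Lemma residueBr P F Q1 Q2 :
  residue P F (Q1 - Q2) = residue P F Q1 - residue P F Q2.
Proof.
by rewrite !(residue_trE _ F) /trmx_poly raddfB /= residueBl raddfB.
Qed.

Lemma residueCr P F Q C : residue P F (Q * C%:P) = residue P F Q * C.
Proof.
rewrite !(residue_trE _ F).
have -> : trmx_poly (Q * C%:P) = (C^T)%:P * trmx_poly Q.
  by apply/polyP => i; rewrite coef_trmx_poly coefMC coefCM coef_trmx_poly -!mulmxE trmx_mul.
by rewrite residueCl -mulmxE trmx_mul trmxK.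
Qed.

(** The moments depend only on the sum of the two indices (the Hankel
structure), so multiplication by the variable may be moved across. *)
Lemma residueX P F Q : residue (P * 'X) F Q = residue P F (Q * 'X).
Proof.
have leX (S : {poly M}) : (size (S * 'X)%R <= (size S).+1)%N.
  apply/leq_sizeP => -[//|j] lej; rewrite coefMX /=; exact: nth_default.
rewrite (residue_wide F (leX P) (leqnn _)).
rewrite (residue_wide F (leqnn (size P)) (leX Q)).
rewrite big_ord_recl [X in X + _]big1 ?add0r => [|j _].
  apply: eq_bigr => i _; rewrite [RHS]big_ord_recl [(Q * 'X)`_ord0]coefMX /= mulr0 add0r.
  by apply: eq_bigr => j _; rewrite !coefMX /= /bump !add1n addnS.
by rewrite coefMX /= !mul0r.
Qed.

(** Besides [residueX], this uses that a scalar matrix is central: it leaves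
the pairing on the left or on the right with the same effect. *)
Lemma residue_shift P F Q z :
  residue (P * ((z%:M)%:P - 'X)) F Q = residue P F (Q * ((z%:M)%:P - 'X)).
Proof.
rewrite !mulrBr residueBl residueBr residueX residueCr; congr (_ - _).
have -> : P * (z%:M)%:P = (z%:M)%:P * P.
  by apply/polyP => i; rewrite coefCM coefMC -!mulmxE scalar_mxC.
by rewrite residueCl -!mulmxE scalar_mxC.
Qed.

End Residue.

(** * Bi-orthogonal sequences for the pairing *)

Section Biorthogonal.
Variables (K : fieldType) (n : nat).
Local Notation M := 'M[K]_n.+1.

(** Here F is an arbitrary sequence of moments, not only [markov h U]: the
transposed moments must be allowed for the symmetry below. *)
Definition residue_biorthogonal (F : nat -> M) (V G : nat -> {poly M}) :=
  [/\ forall m, size (V m) = m.+1, forall m, size (G m) = m.+1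
    & forall l m, residue (V m) F (G l) = (l == m)%:R].

Lemma residue_biorthogonal_tr {F V G} : residue_biorthogonal F V G ->
  residue_biorthogonal (fun k => (F k)^T) (@trmx_poly K n \o G) (@trmx_poly K n \o V).
Proof.
case=> sV sG bi; split=> [m|m|l m] /=; rewrite ?size_trmx_poly //.
by rewrite residue_tr bi eq_sym; case: eqP; rewrite ?trmx1 ?trmx0.
Qed.

Section Left.
Variables (F : nat -> M) (V G : nat -> {poly M}).
Hypothesis bi : residue_biorthogonal F V G.

(** One step of the Euclidean division by V_m, the quotient being a constant
acting on the left. *)
Lemma size_sub_lead m (P : {poly M}) :
  (size P <= m.+1)%N -> (V m)`_m \is a GRing.unit ->
  (size (P - (P`_m / (V m)`_m)%:P * V m)%R <= m)%N.
Proof.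
case: bi => sV _ _ sP uV; apply/leq_sizeP => j; rewrite leq_eqVlt coefB coefCM.
case/predU1P => [<-|lt_mj]; first by rewrite divrK ?subrr.
have sPj := leq_trans sP lt_mj.
by rewrite (nth_default _ sPj) [(V m)`_j]nth_default ?sV // mulr0 subr0.
Qed.

(** Stripping one leading term at a time writes P as a left combination of
V_0, ..., V_(m-1), each orthogonal to G_k.  Invertibility is assumed only
below m, which is what is known during the induction of [lead_unit]. *)
Lemma residue_low_units m k (P : {poly M}) :
  (forall l, (l < m)%N -> (V l)`_l \is a GRing.unit) ->
  (size P <= m)%N -> (m <= k)%N -> residue P F (G k) = 0.
Proof.
elim: m P => [|m IHm] P uV sP lemk.
  by move: sP; rewrite leqn0 size_poly_eq0 => /eqP->; apply: residue0l.
have um := uV m (ltnSn m).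
rewrite -[P](subrK ((P`_m / (V m)`_m)%:P * V m)) residueDl residueCl.
case: bi => _ _ ->; rewrite (gtn_eqF lemk) mulr0 addr0.
apply: IHm; [by move=> l /leqW/uV | exact: size_sub_lead | exact: ltnW].
Qed.

(** G_m annihilates everything below the leading term of V_m, so
1 = <V_m, G_m> = lc_m <z^m, G_m>. *)
Lemma lead_unit m : (V m)`_m \is a GRing.unit.
Proof.
elim/ltn_ind: m => m IHm; case: (bi) => sV sG biVG.
have sR : (size (V m - ((V m)`_m)%:P * 'X^m)%R <= m)%N.
  apply/leq_sizeP => j; rewrite leq_eqVlt coefB coefCM coefXn.
  case/predU1P => [<-|lt_mj]; first by rewrite eqxx mulr1 subrr.
  by rewrite [(V m)`_j]nth_default ?sV // (gtn_eqF lt_mj) mulr0 subrr.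
have := biVG m m; rewrite eqxx -[X in residue X](subrK (((V m)`_m)%:P * 'X^m)).
rewrite residueDl (residue_low_units IHm sR) // add0r residueCl -mulmxE.
by case/mulmx1_unit.
Qed.

Lemma residue_low m k (P : {poly M}) :
  (size P <= m)%N -> (m <= k)%N -> residue P F (G k) = 0.
Proof. by apply: residue_low_units => l _; apply: lead_unit. Qed.

(** P differs from (p_m lc_m^-1) V_m by terms of degree less than m, which
are orthogonal to G_m. *)
Lemma residue_lead m (P : {poly M}) :
  (size P <= m.+1)%N -> residue P F (G m) = P`_m / (V m)`_m.
Proof.
move=> sP; rewrite -[X in residue X](subrK ((P`_m / (V m)`_m)%:P * V m)).
rewrite residueDl (@residue_low m m) ?size_sub_lead ?lead_unit //.
by rewrite add0r residueCl; case: bi => _ _ ->; rewrite eqxx mulr1.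
Qed.

End Left.

(** The mirror image of [residue_low], obtained by transposition, which turns
the pair (V, G) into a bi-orthogonal pair (G, V). *)
Lemma residue_low_right F V G m k (Q : {poly M}) : residue_biorthogonal F V G ->
  (size Q <= m)%N -> (m <= k)%N -> residue (V k) F Q = 0.
Proof.
move=> /residue_biorthogonal_tr bi sQ lemk; rewrite residue_trE.
by rewrite (@residue_low _ _ _ bi m k) ?size_trmx_poly ?trmx0.
Qed.

Lemma size_divdiff (P : {poly M}) z : (size (divdiff P z) <= (size P).-1)%N.
Proof.
have [->|nz] := eqVneq (divdiff P z) 0; first by rewrite size_poly0.
have := size_Mmonic nz (monicXsubC (z%:M)).
rewrite -[_ * _]opprK -mulrN opprB divdiffP size_polyN size_XsubC addn2 /= => e.
have: (size ((P.[z%:M])%:P - P)%R <= maxn 1 (size P))%N.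
  rewrite (leq_trans (size_polyD _ _)) // size_polyN geq_max !leq_max.
  by rewrite size_polyC_leq1 leqnn orbT.
by rewrite e; case: (size P) => [|[|s]]; rewrite ?maxn0 ?max1n ?maxnn //=.
Qed.

(** Compare the coefficients of w^(m+1) in
(D P)(w) (z - w) = P(z) - P(w): D P has degree at most m, so only its top
term contributes. *)
Lemma coef_divdiff (P : {poly M}) z m : size P = m.+2 ->
  (divdiff P z)`_m = P`_m.+1.
Proof.
move=> sP; have := congr1 (fun q : {poly M} => q`_m.+1) (divdiffP P z).
rewrite mulrBr !coefB coefMX coefMC coefC /= sub0r.
have sD := size_divdiff P z; rewrite sP /= in sD.
by rewrite nth_default // mul0r sub0r => /oppr_inj.
Qed.

(** The matrix factors G_m(z) and V_(m+1)(z) are constants for the pairing;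
carried inside it, they turn the left-hand side into <D V_(m+1), G_m>. *)
Lemma residue_divdiff_biorthogonal F V G m z : residue_biorthogonal F V G ->
  residue (divdiff (V m.+1) z) F 1 * (G m).[z%:M]
    - (V m.+1).[z%:M] * residue 1 F (divdiff (G m) z)
  = (V m.+1)`_m.+1 / (V m)`_m.
Proof.
move=> bi; case: (bi) => sV sG _.
have e : residue (divdiff (V m.+1) z) F ((G m).[z%:M]%:P - G m)
    = (V m.+1).[z%:M] * residue 1 F (divdiff (G m) z).
  rewrite -divdiffP -residue_shift divdiffP residueBl.
  rewrite (@residue_low_right _ _ _ m m.+1 _ bi) ?subr0 //.
    by rewrite -[X in residue X]mulr1 residueCl.
  by rewrite (leq_trans (size_divdiff _ _)) // sG.
rewrite -residueCr mul1r -e -residueBr subKr (residue_lead bi).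
  by rewrite coef_divdiff ?sV.
by rewrite (leq_trans (size_divdiff _ _)) // sV.
Qed.

End Biorthogonal.

(** * From vectors of functionals to the pairing *)

Section Functional.
Variables (K : fieldType) (n : nat) (h : {poly K}).
Variable U : 'I_n.+1 -> {scalar {poly K}}.
Local Notation M := 'M[K]_n.+1.
Implicit Types (P Q : {poly M}) (C : M).

Lemma vecpolyD P Q : vecpoly h (P + Q) = vecpoly h P + vecpoly h Q.
Proof. by rewrite /vecpoly /comp_mx raddfD hornerD mulmxDl. Qed.

Lemma vecpolyCM C P : vecpoly h (C%:P * P) = map_mx polyC C *m vecpoly h P.
Proof.
by rewrite /vecpoly /comp_mx rmorphM /= map_polyC hornerCM -mulmxE mulmxA.
Qed.

Lemma vecpolyMX P : vecpoly h (P * 'X) = h *: vecpoly h P.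
Proof.
rewrite /vecpoly /comp_mx rmorphM /= map_polyX hornerMX -mulmxE mul_mx_scalar.
by rewrite scalemxAl.
Qed.

Lemma vecpoly0 : vecpoly h (0 : {poly M}) = 0.
Proof. by rewrite /vecpoly /comp_mx raddf0 horner0 mul0mx. Qed.

Lemma vecpoly1 : vecpoly h (1 : {poly M}) = P0 K n.
Proof. by rewrite /vecpoly /comp_mx rmorph1 hornerC mul1mx. Qed.

Lemma vact_residue P : vact U (vecpoly h P) = residue P (markov h U) 1.
Proof.
rewrite -vactT_residue /vactT size_poly1 big_ord1.
by rewrite expr0 scale1r coefC mulmx1.
Qed.

Lemma vactT_P0_residue Q : vactT h U Q (P0 K n) = residue 1 (markov h U) Q.
Proof. by rewrite -vactT_residue vecpoly1. Qed.

Lemma biorthogonal_residue V G : biorthogonal h U V G ->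
  residue_biorthogonal (markov h U) V G.
Proof.
move/biorthogonalP => [sV sG bi]; split=> // l m.
by rewrite bi; case: eqP; rewrite ?raddf0.
Qed.

(** Pairing the recurrence with G_(m+1) keeps only the term in A_m, and
A_m = <z V_m, G_(m+1)> is then given by [residue_lead]. *)
Lemma recurrence_coefA V G A Bc Cc m :
  biorthogonal h U V G -> recurrence h V A Bc Cc ->
  A m = (V m)`_m / (V m.+1)`_m.+1.
Proof.
move=> /biorthogonal_residue bi rec; case: (bi) => sV _ biVG.
have: vecpoly h (V m * 'X) = vecpoly h
    ((A m)%:P * V m.+1 + (Bc m)%:P * V m + (Cc m)%:P * pred_seq V m).
  rewrite vecpolyMX !vecpolyD !vecpolyCM rec; congr (_ + _ *m _).
  by case: m => [|m] //=; rewrite vecpoly0.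
move=> /(congr1 (vactT h U (G m.+1))).
rewrite !vactT_residue !residueDl !residueCl !biVG eqxx (gtn_eqF (ltnSn m)).
have -> : residue (pred_seq V m) (markov h U) (G m.+1) = 0.
  case: m => [|m] /=; first exact: residue0l.
  by rewrite biVG (gtn_eqF (leqnSn m.+1)).
rewrite !mulr0 mulr1 !addr0 (residue_lead bi) ?coefMX //.
rewrite (leq_trans (size_polyMleq _ _)) // size_polyX addn2 sV //.
Qed.

End Functional.

Unset Implicit Arguments.
Set Strict Implicit.

Theorem theorem1 (R : realType) (n : nat) (h : {poly (complex R)})
    (U : 'I_n.+1 -> {scalar {poly (complex R)}})
    (V G : nat -> {poly 'M[complex R]_n.+1})
    (A Bc Cc : nat -> 'M[complex R]_n.+1)
    (deg_h : size h = n.+2)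
    (qdU : quasi_definite h U)
    (biVG : biorthogonal h U V G)
    (recV : recurrence h V A Bc Cc)
    (m : nat) (z : complex R) :
  A m \in unitmx /\
  assocB h U V m z *m (G m).[z%:M]
    - (V m.+1).[z%:M] *m pred_seq (fun k => assocG h U G k z) m
  = invmx (A m).
Proof.
have bi := biorthogonal_residue biVG.
have uV k := lead_unit bi k.
have eA := recurrence_coefA m biVG recV.
split.
  by change (A m \is a GRing.unit); rewrite eA; apply: rpred_div; apply: uV.
(* At m = 0 the value 0 set for G^(1)_(-1) agrees with the general formula,
   as the divided difference of the constant G_0 vanishes. *)
have eG : pred_seq (fun k => assocG h U G k z) m
          = residue 1 (markov h U) (divdiff (G m) z).
  case: m {eA} => [|m] /=; last exact: vactT_P0_residue.
  have sD := size_divdiff (G 0%N) z; case: bi => _ sG _.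
  move: sD; rewrite sG leqn0 size_poly_eq0 => /eqP->.
  by rewrite /residue size_poly0 exchange_big big_ord0.
rewrite eG /assocB vact_residue !mulmxE (residue_divdiff_biorthogonal _ _ bi).
by rewrite eA; change (invmx ?x) with (x^-1); rewrite invrM ?unitrV ?invrK.
Qed.
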